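(* Let $d\ge 2$ and $p\ge 1$, let $\mathbf H_1,\dots,\mathbf H_p\in\mathbb C^{d\times d}$ be Hermitian with $\mathbf H_l^2=\mathbf I$ (two-level Hamiltonians with eigenvalues in $\{\pm1\}$), let $\mathbf M\in\mathbb C^{d\times d}$ be Hermitian, and suppose the QNN $(\mathbf H_1,\dots,\mathbf H_p;\mathbf M)$ is with linear independence. Then there exists a finite dataset $\mathcal S$ such that, within one period $[0,\pi)^p$, the loss $L(\boldsymbol\theta;\mathcal S)$ has (at least) $2^p$ local minima, and $2^p-1$ of these are spurious, i.e. their loss values exceed the global minimum value of $L(\cdot;\mathcal S)$ by a strictly positive amount.
   Context: A $p$-parameter QNN on a $d$-dimensional system is given by Hermitian matrices $\mathbf H_1,\dots,\mathbf H_p$ and a Hermitian observable $\mathbf M$; for $\boldsymbol\theta\in\mathbb R^p$ set $\mathbf U(\boldsymbol\theta)=e^{-i\theta_p\mathbf H_p}\cdots e^{-i\theta_1\mathbf H_1}$ (matrix exponentials). A dataset is a finite set $\mathcal S=\{(\boldsymbol\rho_i,y_i)\}_{i=1}^m$ with each $\boldsymbol\rho_i\in\mathbb C^{d\times d}$ a density matrix (positive semidefinite, trace $1$) and $y_i\in\mathbb R$. The loss is $L(\boldsymbol\theta;\mathcal S)=\frac1m\sum_{i=1}^m\big(\operatorname{tr}(\mathbf U(\boldsymbol\theta)\boldsymbol\rho_i\mathbf U(\boldsymbol\theta)^\dagger\mathbf M)-y_i\big)^2$. When $\mathbf H_l^2=\mathbf I$ for all $l$, $L$ is $\pi$-periodic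 in each coordinate. For $l\in[p]$ and Hermitian $\mathbf A$ define $\Phi_l^{(0)}(\mathbf A)=\frac12(\mathbf A+\mathbf H_l\mathbf A\mathbf H_l)$, $\Phi_l^{(1)}(\mathbf A)=\frac12(\mathbf A-\mathbf H_l\mathbf A\mathbf H_l)$, $\Phi_l^{(2)}(\mathbf A)=\frac i2[\mathbf H_l,\mathbf A]$ where $[\mathbf X,\mathbf Y]=\mathbf X\mathbf Y-\mathbf Y\mathbf X$, and for $\boldsymbol\xi\in\{0,1,2\}^p$ let $\Phi_{\boldsymbol\xi}=\Phi_1^{(\xi_1)}\circ\Phi_2^{(\xi_2)}\circ\cdots\circ\Phi_p^{(\xi_p)}$. The QNN is said to be with linear independence if the $3^p-1$ matrices $\{\Phi_{\boldsymbol\xi}(\mathbf M)\}_{\boldsymbol\xi\in\{0,1,2\}^p\setminus\{\mathbf 0\}}$ are linearly independent (over $\mathbb R$, as Hermitian matrices). *)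

(* Defs.v *)
From HB Require Import structures.
From mathcomp Require Import all_boot all_order all_algebra.
From mathcomp Require Import all_classical all_reals all_analysis.
From mathcomp Require Import complex.
Import numFieldNormedType.Exports.
Import Order.TTheory GRing.Theory Num.Theory.

Set Implicit Arguments.
Unset Strict Implicit.
Unset Printing Implicit Defensive.

Local Open Scope ring_scope.

Section QNN.
Variable R : realType.
Local Notation C := (R[i]).

Definition conjT (m n : nat) (A : 'M[C]_(m, n)) : 'M[C]_(n, m) :=
  (map_mx (@conjc R) A)^T.

Definition is_hermitian (d : nat) (A : 'M[C]_d) : Prop := conjT A = A.

Definition psd (d : nat) (A : 'M[C]_d) : Prop :=
  is_hermitian A /\ forall v : 'cV[C]_d, 0 <= (conjT v *m A *m v) 0 0.

Definition density_matrix (d : nat) (rho : 'M[C]_d) : Prop :=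
  psd rho /\ \tr rho = 1.

Definition expmx_partial (d : nat) (A : 'M[C]_d) (N : nat) : 'M[C]_d :=
  \sum_(k < N) ((k`!)%:R^-1 : C) *: A ^+ k.

Definition expmx (d : nat) (A : 'M[C]_d) : 'M[C]_d :=
  \matrix_(i, j)
    Complex (limn (fun N => complex.Re (expmx_partial A N i j)) : R)
            (limn (fun N => complex.Im (expmx_partial A N i j)) : R).

(* U(theta) = e^{-i theta_p H_p} ... e^{-i theta_1 H_1}
   (index l : 'I_p corresponds to the paper's l+1) *)
Definition qnn_U (d p : nat) (H : 'I_p -> 'M[C]_d) (theta : 'I_p -> R)
  : 'M[C]_d :=
  foldl (fun acc l => expmx (Complex 0 (- theta l) *: H l) *m acc)
        1%:M (enum 'I_p).

(* a dataset is a finite list of (density matrix, label) pairs *)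
Definition loss (d p : nat) (H : 'I_p -> 'M[C]_d) (M : 'M[C]_d)
  (S : seq ('M[C]_d * R)) (theta : 'I_p -> R) : R :=
  let U := qnn_U H theta in
  (size S)%:R^-1 *
    \sum_(s <- S) (complex.Re (\tr (U *m s.1 *m conjT U *m M)) - s.2) ^+ 2.

Definition Phi_l (d : nat) (Hl : 'M[C]_d) (k : 'I_3) (A : 'M[C]_d)
  : 'M[C]_d :=
  match val k with
  | 0 => Complex 2^-1 0 *: (A + Hl *m A *m Hl)
  | 1 => Complex 2^-1 0 *: (A - Hl *m A *m Hl)
  | _ => Complex 0 2^-1 *: (Hl *m A - A *m Hl)
  end.

Definition Phi_xi (d p : nat) (H : 'I_p -> 'M[C]_d) (xi : {ffun 'I_p -> 'I_3})
  (A : 'M[C]_d) : 'M[C]_d :=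
  foldr (fun l acc => Phi_l (H l) (xi l) acc) A (enum 'I_p).

Definition qnn_lin_indep (d p : nat) (H : 'I_p -> 'M[C]_d) (M : 'M[C]_d)
  : Prop :=
  forall c : {ffun 'I_p -> 'I_3} -> R,
    \sum_(xi | xi != [ffun => ord0]) Complex (c xi) 0 *: Phi_xi H xi M = 0 ->
    forall xi, xi != [ffun => ord0] -> c xi = 0.

Definition local_min (p : nat) (f : ('I_p -> R) -> R) (theta : 'I_p -> R)
  : Prop :=
  exists2 e : R, 0 < e &
    forall theta', (forall l, `|theta' l - theta l| < e) -> f theta <= f theta'.

End QNN.

(* Main.v *)
Require Import Defs.
From HB Require Import structures.
From mathcomp Require Import all_boot all_order all_algebra.
From mathcomp Require Import all_classical all_reals all_analysis.
From mathcomp Require Import complex ring lra.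
Import numFieldNormedType.Exports.
Import Order.TTheory GRing.Theory Num.Theory.
Local Open Scope ring_scope.

Set Implicit Arguments.
Unset Strict Implicit.
Unset Printing Implicit Defensive.

(** In the Heisenberg picture, conjugating by [exp (- i x H_l)] with [H_l ^ 2 = 1]
    acts as [Phi_l^0 + cos 2x Phi_l^1 + sin 2x Phi_l^2], so the expectation
    [tr (U rho U^* M)] is a trigonometric polynomial with coefficients
    [tr (rho Phi_xi(M))].  The [Phi_xi(M)] with [xi <> 0] are traceless and
    Hermitian; inverting their Gram matrix gives a dual family [X_xi], and
    [1/d + t X_xi] is a density matrix for small [t] which isolates, up to a
    constant absorbed in the label, the monomial of [xi].  Using only the
    monomials [sin (2 theta_l)] and [cos (2 theta_l)], the loss becomes a positive
    multiple of [sum_l ((2 sin 2theta_l)^2 + (cos 2theta_l - 1)^2)]; each summand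
    has its minimum [0] at [theta_l = 0] and a local minimum of value [4] at
    [theta_l = pi/2]. *)

Section ComplexMatrices.
Local Open Scope classical_set_scope.
Variable R : realType.
Local Notation C := (R[i]).
Local Notation Re := (@complex.Re R).

(** * Adjoints and the real trace form on Hermitian matrices *)

Lemma conjTM m n q (A : 'M[C]_(m, n)) (B : 'M[C]_(n, q)) :
  conjT (A *m B) = conjT B *m conjT A.
Proof. by rewrite /conjT map_mxM trmx_mul. Qed.

Lemma conjTD m n (A B : 'M[C]_(m, n)) : conjT (A + B) = conjT A + conjT B.
Proof. by rewrite /conjT map_mxD linearD. Qed.

Lemma conjTN m n (A : 'M[C]_(m, n)) : conjT (- A) = - conjT A.
Proof. by rewrite /conjT map_mxN linearN. Qed.

Lemma conjTZ m n (a : C) (A : 'M[C]_(m, n)) :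
  conjT (a *: A) = (conjc a) *: conjT A.
Proof. by rewrite /conjT map_mxZ linearZ. Qed.

Lemma conjT_sum m n (I : Type) (r : seq I) (F : I -> 'M[C]_(m, n)) :
  conjT (\sum_(i <- r) F i) = \sum_(i <- r) conjT (F i).
Proof. by rewrite /conjT map_mx_sum linear_sum. Qed.

Lemma conjTK m n : cancel (@conjT R m n) (@conjT R n m).
Proof. by move=> A; apply/matrixP => i j; rewrite !mxE conjcK. Qed.

Lemma conjT_scalar n (a : C) : conjT (a%:M : 'M[C]_n) = (conjc a)%:M.
Proof. by rewrite /conjT map_scalar_mx tr_scalar_mx. Qed.

Lemma ReZ (a : R) (z : C) : Re (Complex a 0 * z) = a * Re z.
Proof. by case: z => x y /=; rewrite mul0r subr0. Qed.

Lemma Re_tr_sum d (I : Type) (r : seq I) (P : pred I) (F : I -> 'M[C]_d) :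
  Re (\tr (\sum_(i <- r | P i) F i)) = \sum_(i <- r | P i) Re (\tr (F i)).
Proof. by rewrite (raddf_sum (@mxtrace C d)) (raddf_sum Re). Qed.

(** The trace is the squared Frobenius norm, a sum of nonnegative terms; it is therefore real, and
    its real part alone decides whether it vanishes. *)
Lemma mxtrace_mul_conjT_eq0 d (A : 'M[C]_d) :
  Re (\tr (A *m conjT A)) = 0 -> A = 0.
Proof.
have -> : \tr (A *m conjT A) = \sum_i \sum_j `|A i j| ^+ 2.
  apply: eq_bigr => i _; rewrite mxE; apply: eq_bigr => j _.
  by rewrite !mxE sqr_normc.
set t := \sum_i _ => Ht.
have t0 : t = 0.
  have : 0 <= t by apply: sumr_ge0 => i _; apply: sumr_ge0 => j _; rewrite exprn_ge0.
  move/ger0_Im; move: Ht; case: (t) => x y /= -> ->; exact: erefl.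
apply/matrixP => i j; rewrite mxE; move/eqP: t0.
rewrite psumr_eq0 => [/allP/(_ i (mem_index_enum _))/=|k _]; last first.
  by apply: sumr_ge0 => l _; rewrite exprn_ge0.
rewrite psumr_eq0 => [/allP/(_ j (mem_index_enum _))/=|l _]; last by rewrite exprn_ge0.
by rewrite sqrf_eq0 normr_eq0 => /eqP.
Qed.

(** A row [v] killed by the Gram matrix [G] gives a Hermitian [N] with [tr (N N) = 0], so [N = 0]
    and independence forces [v = 0]. The rows of [invmx G] are then the real coefficients of the
    dual family. *)
Lemma hermitian_dual_family d n (F : 'I_n -> 'M[C]_d) :
  (forall i, is_hermitian (F i)) ->
  (forall c : 'I_n -> R, \sum_i Complex (c i) 0 *: F i = 0 -> forall i, c i = 0) ->
  exists X : 'I_n -> 'M[C]_d, forall i,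
    [/\ is_hermitian (X i), (forall j, \tr (F j) = 0) -> \tr (X i) = 0 &
        forall j, Re (\tr (X i *m F j)) = (i == j)%:R].
Proof.
move=> hF indF.
pose G : 'M[R]_n := \matrix_(i, j) Re (\tr (F i *m F j)).
have Gunit : G \in unitmx.
  rewrite -row_free_unit; apply: inj_row_free => v vG.
  pose N := \sum_i Complex (v 0 i) 0 *: F i.
  have hN : conjT N = N.
    rewrite /N conjT_sum; apply: eq_bigr => i _.
    by rewrite conjTZ hF /= oppr0.
  have trN : Re (\tr (N *m N)) = (v *m G *m v^T) 0 0.
    rewrite {2}/N mulmx_sumr Re_tr_sum mxE; apply: eq_bigr => j _ /=.
    rewrite -scalemxAr mxtraceZ ReZ mulrC !mxE /N mulmx_suml Re_tr_sum.
    congr (_ * _); apply: eq_bigr => i _ /=.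
    by rewrite -scalemxAl mxtraceZ ReZ mxE.
  have /indF v0 : N = 0.
    by apply: mxtrace_mul_conjT_eq0; rewrite hN trN vG mul0mx mxE.
  by apply/rowP => i; rewrite v0 mxE.
exists (fun i => \sum_k Complex (invmx G i k) 0 *: F k) => i; split.
- rewrite /is_hermitian conjT_sum; apply: eq_bigr => k _.
  by rewrite conjTZ hF /= oppr0.
- move=> tr0; rewrite (raddf_sum (@mxtrace C d)) big1 // => k _.
  by rewrite /= mxtraceZ tr0 mulr0.
- move=> j; rewrite mulmx_suml Re_tr_sum.
  transitivity ((invmx G *m G) i j); last by rewrite mulVmx // mxE.
  rewrite mxE; apply: eq_bigr => k _ /=.
  by rewrite -scalemxAl mxtraceZ ReZ mxE.
Qed.

(** The quadratic form of [X] at [v] is at most the entrywise 1-norm of [X] times the squared norm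
    of [v]; this crude bound avoids eigenvalues. *)
Lemma psd_scalar_add d (X : 'M[C]_d) (s t : R) :
  is_hermitian X -> 0 <= t ->
  Complex t 0 * (\sum_i \sum_j `|X i j|) <= Complex s 0 ->
  psd ((Complex s 0)%:M + Complex t 0 *: X).
Proof.
move=> hX t0 tX; split.
  by rewrite /is_hermitian conjTD conjTZ hX conjT_scalar /= !oppr0.
move=> v; set q := (_ *m _) 0 0.
pose w := \sum_k `|v k 0| ^+ 2.
have vw k : `|v k 0| ^+ 2 <= w.
  rewrite /w (bigD1 k) //= lerDl; apply: sumr_ge0 => l _; exact: exprn_ge0.
pose z := (conjT v *m X *m v) 0 0.
have -> : q = Complex s 0 * w + Complex t 0 * z.
  rewrite /q mulmxDr mulmxDl mul_mx_scalar -scalemxAr -!scalemxAl !mxE /w /z.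
  congr (_ * _ + _ * _); last by rewrite mxE.
  by apply: eq_bigr => k _; rewrite !mxE sqr_normc mulrC.
have zR : z \is Num.real.
  rewrite CrealE /z; apply/eqP.
  have : conjT (conjT v *m X *m v) = conjT v *m X *m v.
    by rewrite !conjTM conjTK hX mulmxA.
  by move/matrixP/(_ 0 0); rewrite mxE [LHS]mxE.
have zle : `|z| <= (\sum_i \sum_j `|X i j|) * w.
  have -> : z = \sum_j \sum_i conjc (v i 0) * X i j * v j 0.
    rewrite /z mxE; apply: eq_bigr => j _; rewrite mxE mulr_suml.
    by apply: eq_bigr => i _; rewrite !mxE.
  rewrite exchange_big /= mulr_suml; apply: le_trans (ler_norm_sum _ _ _) _.
  apply: ler_sum => i _; rewrite mulr_suml.
  apply: le_trans (ler_norm_sum _ _ _) _; apply: ler_sum => j _.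
  rewrite !normrM normcJ [X in X * _]mulrC -mulrA ler_wpM2l //.
  (* A product of two moduli is at most the larger square, hence at most [w]. *)
  have ab (a b : C) : 0 <= a -> 0 <= b -> a ^+ 2 <= w -> b ^+ 2 <= w -> a * b <= w.
    move=> a0 b0 aw bw.
    case/orP: (real_leVge (ger0_real a0) (ger0_real b0)) => le_ab.
      by apply: le_trans bw; rewrite expr2 ler_wpM2r.
    by apply: le_trans aw; rewrite expr2 ler_wpM2l.
  exact: ab.
have w0 : 0 <= w by apply: sumr_ge0 => k _; rewrite exprn_ge0.
have tzR : Complex t 0 * z \is Num.real by rewrite realM // complex_real.
have : `|Complex t 0 * z| <= Complex s 0 * w.
  rewrite normrM ger0_norm ?ler0c //.
  apply: le_trans (ler_wpM2r w0 tX); rewrite -mulrA ler_wpM2l ?ler0c //.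
by rewrite real_ler_norml // => /andP[+ _]; rewrite lerNl -subr_ge0 opprK addrC.
Qed.

(** * Exponential of an involution *)

Lemma complexDE (a b c d : R) : Complex a b + Complex c d = Complex (a + c) (b + d) :> C.
Proof. by []. Qed.

Lemma complexNE (a b : R) : - Complex a b = Complex (- a) (- b) :> C.
Proof. by []. Qed.

Lemma complexME (a b c d : R) :
  Complex a b * Complex c d = Complex (a * c - b * d) (a * d + b * c) :> C.
Proof. by []. Qed.

Definition complex_opE := (complexDE, complexNE, complexME).

(** Even powers of [- i x A] are scalar and odd ones are multiples of [A], so the partial sums are
    exactly those of the cosine and sine series. *)
Lemma expmx_involution d (A : 'M[C]_d) (x : R) : A *m A = 1%:M ->
  expmx (Complex 0 (- x) *: A) =
  (Complex (cos x) 0)%:M - Complex 0 (sin x) *: A.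
Proof.
move=> AA.
have partE N : expmx_partial (Complex 0 (- x) *: A) N =
    (Complex (series (cos_coeff x) N) 0)%:M
    - Complex 0 (series (sin_coeff x) N) *: A.
  elim: N => [|N IH].
    rewrite /expmx_partial big_ord0 /series /= !big_geq // scale0r subr0.
    by apply/matrixP => i j; rewrite !mxE mul0rn.
  rewrite /expmx_partial big_ord_recr /= -/(expmx_partial _ N) IH.
  have -> : (Complex 0 (- x) *: A) ^+ N =
      if odd N then Complex 0 (- ((-1) ^+ N./2 * x ^+ N)) *: A
      else (Complex ((-1) ^+ N./2 * x ^+ N) 0)%:M.
    have xx : (Complex 0 (- x) *: A) ^+ 2 = (Complex (- x ^+ 2) 0)%:M.
      rewrite -[LHS]/(_ *m _) -scalemxAl -scalemxAr AA scalerA scalemx1; congr _%:M.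
      by rewrite complex_opE; congr Complex; ring.
    have evenE k : (Complex 0 (- x) *: A) ^+ k.*2 = (Complex ((-1) ^+ k * x ^+ k.*2) 0)%:M.
      elim: k => [|k IHk]; first by rewrite !expr0 mulr1.
      rewrite doubleS -addn2 exprD IHk xx -[LHS]/(_ *m _) -scalar_mxM; congr _%:M.
      rewrite complex_opE exprD [(-1) ^+ k.+1]exprS.
      by move: (x ^+ k.*2) ((-1) ^+ k : R) => y w; congr Complex; ring.
    have -> : x ^+ N = x ^+ odd N * x ^+ N./2.*2 by rewrite -exprD odd_double_half.
    rewrite -[in LHS](odd_double_half N) exprD evenE.
    case: (odd N); last by rewrite !expr0 mul1r mul1r.
    rewrite !expr1 -[LHS]/(_ *m _) mul_mx_scalar scalerA; congr (_ *: _).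
    move: (x ^+ _.*2) ((-1) ^+ N./2 : R) => y w.
    by rewrite complex_opE; congr Complex; ring.
  have -> : ((N`!)%:R^-1 : C) = Complex (N`!%:R^-1) 0.
    by rewrite -(rmorph_nat (real_complex R)) -fmorphV.
  have cosE : cos_coeff x N = (~~ odd N)%:R * (-1) ^+ N./2 * x ^+ N * N`!%:R^-1 by [].
  (* [sin_coeff] carries the exponent [N.-1./2]: it agrees with [N./2] for odd [N], and for even [N]
     the parity factor kills the term. *)
  have sinE : sin_coeff x N = (odd N)%:R * (-1) ^+ N./2 * x ^+ N * N`!%:R^-1.
    rewrite -[LHS]/((odd N)%:R * (-1) ^+ N.-1./2 * x ^+ N * N`!%:R^-1).
    case oN: (odd N); last by rewrite !mul0r.
    suff -> : N.-1./2 = N./2 by [].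
    by rewrite -[N in N.-1](odd_double_half N) oN add1n doubleK.
  rewrite !seriesSr cosE sinE {cosE sinE}.
  move: (series (cos_coeff x) N) (series (sin_coeff x) N) => Sc Ss.
  move: (N`!%:R^-1 : R) (x ^+ N) ((-1) ^+ N./2 : R) => v y w.
  case: (odd N).
    rewrite !mul0r addr0 mul1r scalerA -addrA -!(scaleNr _ A) -scalerDl !complex_opE.
    by congr (_ + _ *: _); congr Complex; ring.
  rewrite !mul0r addr0 mul1r scale_scalar_mx complex_opE addrAC -raddfD complex_opE.
  by congr (_%:M - _); congr Complex; ring.
apply/matrixP => i j; rewrite !mxE.
set u := (A i j).
have cC : series (cos_coeff x) @ \oo --> cos x.
  by rewrite unlock; exact: is_cvg_series_cos_coeff.
have cS : series (sin_coeff x) @ \oo --> sin x.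
  by rewrite unlock; exact: is_cvg_series_sin_coeff.
have -> : (fun N => Re (expmx_partial (Complex 0 (- x) *: A) N i j)) =
  (fun N => series (cos_coeff x) N * (i == j)%:R + series (sin_coeff x) N * complex.Im u).
  apply/funext => N; rewrite partE !mxE -/u; case: (u) => a b.
  by case: (i == j) => /=; ring.
have -> : (fun N => complex.Im (expmx_partial (Complex 0 (- x) *: A) N i j)) =
  (fun N => - (series (sin_coeff x) N * Re u)).
  apply/funext => N; rewrite partE !mxE -/u; case: (u) => a b.
  by case: (i == j) => /=; ring.
rewrite (cvg_lim _ (cvgD (cvgM cC (cvg_cst _)) (cvgM cS (cvg_cst _)))) //.
rewrite (cvg_lim _ (cvgN (cvgM cS (cvg_cst _)))) //.
by case: (u) => a b; case: (i == j) => /=;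
  rewrite ?mulr1n ?mulr0n ?complex_opE; congr Complex; ring.
Qed.

(** * Expansion of the evolved observable in the [Phi_xi] *)

Lemma eq_in_foldr (I : eqType) (V : Type) (F G : I -> V -> V) (A : V) (s : seq I) :
  {in s, forall i, F i =1 G i} -> foldr F A s = foldr G A s.
Proof.
elim: s => //= l s IH FG; rewrite IH => [|i si]; last by apply: FG; rewrite in_cons si orbT.
by apply: (FG l); rewrite mem_head.
Qed.

(** Multilinear expansion over choice functions. Pinning [xi] to [k0] outside [s] makes each choice
    along [s] count once, as the induction on [s] requires. *)
Lemma foldr_sum (I K : finType) (k0 : K) (V : nmodType) (F : I -> K -> V -> V)
    (s : seq I) (A : V) :
  (forall l k, {morph F l k : x y / x + y}) -> (forall l k, F l k 0 = 0) ->
  uniq s ->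
  foldr (fun l acc => \sum_k F l k acc) A s =
  \sum_(xi : {ffun I -> K} | [forall i, (i \in s) || (xi i == k0)])
    foldr (fun l => F l (xi l)) A s.
Proof.
move=> FD F0; elim: s => [|l s IH] /= => [_|/andP[ls us]].
  rewrite (big_pred1 [ffun=> k0]) // => xi /=.
  apply/forallP/eqP => [xi0|-> i]; last by rewrite ffunE.
  by apply/ffunP => i; rewrite ffunE; apply/eqP/xi0.
rewrite {}IH // [RHS](partition_big (fun xi : {ffun I -> K} => xi l) xpredT) //=.
apply: eq_bigr => k _; rewrite (big_morph _ (FD l k) (F0 l k)).
(* Setting the value at [l] to [k] maps the choices with value [k0] at [l] bijectively onto those
   with value [k]; resetting to [k0] inverts it. *)
pose upd (k : K) (xi : {ffun I -> K}) := [ffun i => if i == l then k else xi i].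
rewrite [RHS](reindex_onto (upd k) (upd k0)) /=; last first.
  by move=> xi /andP[_ /eqP xil]; apply/ffunP => i; rewrite !ffunE; case: eqP => [->|].
apply: eq_big => [xi|xi _].
  rewrite !ffunE eqxx eqxx andbT; apply/forallP/andP => [xi0|[/forallP xi0 /eqP updK] i].
    split; last first.
      apply/eqP/ffunP => i; rewrite !ffunE; case: eqP => // ->.
      by have := xi0 l; rewrite (negPf ls) => /eqP.
    apply/forallP => i; rewrite ffunE in_cons; case: eqP => //= _; exact: xi0.
  have := xi0 i; rewrite in_cons ffunE; case: eqP => //= -> _.
  by rewrite -updK ffunE eqxx eqxx orbT.
rewrite ffunE eqxx; congr (F l k _); apply: eq_in_foldr => i si x.
by rewrite ffunE; case: eqP => // il; rewrite -il si in ls.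
Qed.

Definition trig_weight (k : 'I_3) (x : R) : R :=
  match val k with 0 => 1 | 1 => cos (x *+ 2) | _ => sin (x *+ 2) end.

Lemma Phi_lD d (Hl : 'M[C]_d) k : {morph Phi_l Hl k : A B / A + B}.
Proof.
move=> A B; rewrite /Phi_l; case: (val k) => [|[|?]];
  by rewrite -scalerDr mulmxDr mulmxDl ?opprD addrACA.
Qed.

Lemma Phi_lZ d (Hl : 'M[C]_d) k (a : C) A : Phi_l Hl k (a *: A) = a *: Phi_l Hl k A.
Proof.
rewrite /Phi_l; case: (val k) => [|[|?]];
  by rewrite -scalemxAr -scalemxAl -?scalerBr -?scalerDr !scalerA mulrC.
Qed.

Lemma Phi_l0 d (Hl : 'M[C]_d) k : Phi_l Hl k 0 = 0.
Proof. by rewrite -[X in Phi_l _ _ X](scale0r 0) Phi_lZ scale0r. Qed.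

(** The scalars stand for [a = cos x], [b = i sin x], [h = 1/2], [k = cos 2x] and
    [t = (i/2) sin 2x]; the hypotheses are the double-angle formulas. *)
Lemma scalar_add_conj d (A Hl : 'M[C]_d) (a b h k t : C) :
  a * a = h + k * h -> b * b = k * h - h -> b * a = t ->
  (a%:M + b *: Hl) *m A *m (a%:M - b *: Hl) =
  h *: (A + Hl *m A *m Hl) + (k * h) *: (A - Hl *m A *m Hl)
  + t *: (Hl *m A - A *m Hl).
Proof.
move=> aa bb ba.
rewrite mulmxDl mul_scalar_mx -scalemxAl mulmxBr mul_mx_scalar -scalemxAr.
rewrite !mulmxDl -!scalemxAl !scalerDr !scalerN !scalerA.
rewrite aa bb [a * b]mulrC ba.
move: (Hl *m A *m Hl) (Hl *m A) (A *m Hl) => HAH HA AH.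
apply/matrixP => i j; rewrite !mxE.
by move: (A i j) (HA i j) (AH i j) (HAH i j) => ? ? ? ?; ring.
Qed.

Lemma conjT_expmx_conj d (A Hl : 'M[C]_d) (x : R) :
  is_hermitian Hl -> Hl *m Hl = 1%:M ->
  let e := expmx (Complex 0 (- x) *: Hl) in
  conjT e *m A *m e = \sum_(k < 3) Complex (trig_weight k x) 0 *: Phi_l Hl k A.
Proof.
move=> hH HH e.
rewrite /e expmx_involution // !big_ord_recr big_ord0 /= add0r /Phi_l /trig_weight /=.
rewrite sin_mulr2n cos_mulr2n.
have := cos2Dsin2 x; move: (cos x) (sin x) => c s cs.
have -> : conjT ((Complex c 0)%:M - Complex 0 s *: Hl) =
    (Complex c 0)%:M + Complex 0 s *: Hl.
  rewrite conjTD conjTN conjTZ conjT_scalar hH -scaleNr /= complex_opE oppr0.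
  by rewrite opprK.
pose k : C := Complex (c ^+ 2 *+ 2 - 1) 0; pose h : C := Complex 2^-1 0.
pose t : C := Complex ((c * s) *+ 2) 0 * Complex 0 2^-1.
rewrite (@scalar_add_conj _ A Hl (Complex c 0) (Complex 0 s) h k t).
- by rewrite -[Complex 1 0]/(1 : C) scale1r !scalerA.
- by rewrite complexME complexME complexDE; congr Complex; field.
- have s2 : s * s = 1 - c ^+ 2 by rewrite -cs; ring.
  by rewrite !complexME s2 complexNE complexDE; congr Complex; field.
- by rewrite !complexME; congr Complex; field.
Qed.

(** The last gate is outermost in [U] but acts first on [M], so the left fold becomes a right fold
    over the same list, the order used by [Phi_xi]. *)
Lemma conjT_foldl_mul d (I : Type) (e : I -> 'M[C]_d) (M V : 'M[C]_d) (s : seq I) :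
  let U := foldl (fun acc l => e l *m acc) V s in
  conjT U *m M *m U =
  conjT V *m foldr (fun l acc => conjT (e l) *m acc *m e l) M s *m V.
Proof.
by elim: s V => //= l s IH V; rewrite IH conjTM !mulmxA.
Qed.

Lemma conjT_qnn_U d p (H : 'I_p -> 'M[C]_d) (M : 'M[C]_d) (theta : 'I_p -> R) :
  (forall l, is_hermitian (H l)) -> (forall l, H l *m H l = 1%:M) ->
  conjT (qnn_U H theta) *m M *m qnn_U H theta =
  \sum_(xi : {ffun 'I_p -> 'I_3})
    Complex (\prod_l trig_weight (xi l) (theta l)) 0 *: Phi_xi H xi M.
Proof.
move=> hH HH; rewrite /qnn_U conjT_foldl_mul conjT_scalar conjc1 mul1mx mulmx1.
rewrite (@eq_in_foldr _ _ _
   (fun l acc => \sum_k Complex (trig_weight k (theta l)) 0 *: Phi_l (H l) k acc));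
  last by move=> l _ A /=; exact: conjT_expmx_conj.
rewrite (@foldr_sum _ _ (ord0 : 'I_3) _
   (fun l k acc => Complex (trig_weight k (theta l)) 0 *: Phi_l (H l) k acc)).
- apply: eq_big => [xi|xi _].
    by apply/forallP => l; rewrite mem_enum.
  rewrite -big_enum /Phi_xi; elim: (enum 'I_p) => [|l s IH] /=.
    by rewrite big_nil scale1r.
  rewrite IH Phi_lZ scalerA big_cons; congr (_ *: _).
  exact: (esym (rmorphM (real_complex R) _ _)).
- by move=> l k A B; rewrite Phi_lD scalerDr.
- by move=> l k; rewrite Phi_l0 scaler0.
- exact: enum_uniq.
Qed.

(** * Hermiticity and trace of the [Phi_xi] *)

Lemma Phi_l_hermitian d (Hl A : 'M[C]_d) k :
  is_hermitian Hl -> is_hermitian A -> is_hermitian (Phi_l Hl k A).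
Proof.
rewrite /is_hermitian /Phi_l => hH hA; case: (val k) => [|[|?]];
  rewrite conjTZ conjTD ?conjTN !conjTM hA hH ?mulmxA /= ?oppr0 //.
by rewrite -[in RHS]opprB scalerN -scaleNr [in RHS]/GRing.opp /= oppr0.
Qed.

Lemma Phi_xi_hermitian d p (H : 'I_p -> 'M[C]_d) (M : 'M[C]_d) xi :
  (forall l, is_hermitian (H l)) -> is_hermitian M ->
  is_hermitian (Phi_xi H xi M).
Proof.
by move=> hH hM; rewrite /Phi_xi; elim: (enum 'I_p) => //= l s; exact: Phi_l_hermitian.
Qed.

Lemma mxtrace_Phi_l d (Hl A : 'M[C]_d) k : Hl *m Hl = 1%:M ->
  \tr (Phi_l Hl k A) = if k == ord0 then \tr A else 0.
Proof.
move=> HH; have trH : \tr (Hl *m A *m Hl) = \tr A.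
  by rewrite mxtrace_mulC mulmxA HH mul1mx.
rewrite /Phi_l -val_eqE; case: (val k) => [|[|?]] /=;
  rewrite mxtraceZ !raddfD ?raddfN /= ?trH ?subrr ?mulr0 //.
  by case: (\tr A) => a b; rewrite !complex_opE; congr Complex; field.
by rewrite mxtrace_mulC subrr mulr0.
Qed.

(** One nonzero index makes the trace vanish, and the maps applied after it keep it zero. *)
Lemma mxtrace_Phi_xi d p (H : 'I_p -> 'M[C]_d) (M : 'M[C]_d) (xi : {ffun 'I_p -> 'I_3}) :
  (forall l, H l *m H l = 1%:M) -> xi != [ffun => ord0] ->
  \tr (Phi_xi H xi M) = 0.
Proof.
move=> HH xi0; have [l xil] : exists l, xi l != ord0.
  apply/existsP; apply: contraNT xi0 => /existsPn xi0.
  by apply/eqP/ffunP => l; rewrite ffunE; apply/eqP; move: (xi0 l); rewrite negbK.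
have : l \in enum 'I_p by rewrite mem_enum.
rewrite /Phi_xi; elim: (enum 'I_p) => //= m s IH; rewrite in_cons mxtrace_Phi_l //.
by case: eqP => [lm _|_ /= ls]; [rewrite -lm (negPf xil)|rewrite IH // if_same].
Qed.

(** * States that isolate one monomial *)

Definition perturbed_mixed d (X : 'M[C]_d) (t : R) : 'M[C]_d :=
  (Complex d%:R^-1 0)%:M + Complex t 0 *: X.

Lemma perturbed_mixed_density d (X : 'M[C]_d) :
  (0 < d)%N -> is_hermitian X -> \tr X = 0 ->
  exists2 delta : R, 0 < delta & forall t, 0 <= t <= delta ->
    density_matrix (perturbed_mixed X t).
Proof.
move=> d0 hX trX; pose B : R := Re (\sum_i \sum_j `|X i j|).
have Sge0 : 0 <= \sum_i \sum_j `|X i j| by do 2! apply: sumr_ge0 => ? _.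
have BE : Complex B 0 = \sum_i \sum_j `|X i j| by exact: RRe_real (ger0_real Sge0).
have B0 : 0 <= B by rewrite -ler0c -[B%:C%C]/(Complex B 0) BE.
have dR : 0 < d%:R :> R by rewrite ltr0n.
(* Positivity asks for [t * B <= 1/d]; the denominator [1 + B] stays positive even for [X = 0]. *)
exists (d%:R^-1 / (1 + B)) => [|t /andP[t0 tle]].
  by rewrite divr_gt0 ?invr_gt0 // ltr_pwDl.
split.
  apply: psd_scalar_add => //; rewrite -BE complexME !mulr0 !mul0r subr0 addr0 lecR.
  move: tle; rewrite ler_pdivlMr ?ltr_pwDl // => tle; apply: le_trans tle.
  by rewrite ler_wpM2l // lerDr.
rewrite /perturbed_mixed mxtraceD mxtrace_scalar mxtraceZ trX mulr0 addr0.
by rewrite -[LHS](rmorphMn (real_complex R)) -mulr_natr mulVf ?gt_eqF.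
Qed.

Lemma Re_tr_perturbed_mixed d (X A : 'M[C]_d) (t : R) : \tr A = 0 ->
  Re (\tr (perturbed_mixed X t *m A)) = t * Re (\tr (X *m A)).
Proof.
move=> trA; rewrite mulmxDl mxtraceD mul_scalar_mx mxtraceZ trA mulr0 add0r.
by rewrite -scalemxAl mxtraceZ ReZ.
Qed.

(** Cyclicity of the trace moves the evolution onto [M]. In the expansion, index zero gives a
    constant in [theta], and duality leaves only [xi] among the others. *)
Lemma perturbed_mixed_expect d p (H : 'I_p -> 'M[C]_d) (M X : 'M[C]_d)
    (xi : {ffun 'I_p -> 'I_3}) (t : R) (theta : 'I_p -> R) :
  (forall l, is_hermitian (H l)) -> (forall l, H l *m H l = 1%:M) ->
  xi != [ffun => ord0] ->
  (forall xi', xi' != [ffun => ord0] -> Re (\tr (X *m Phi_xi H xi' M)) = (xi == xi')%:R) ->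
  let U := qnn_U H theta in let rho := perturbed_mixed X t in
  Re (\tr (U *m rho *m conjT U *m M)) =
  Re (\tr (rho *m Phi_xi H [ffun => ord0] M))
  + t * \prod_l trig_weight (xi l) (theta l).
Proof.
move=> hH HH xi0 dualX U rho.
have -> : \tr (U *m rho *m conjT U *m M) = \tr (rho *m (conjT U *m M *m U)).
  by rewrite mulmxA -!mulmxA mxtrace_mulC !mulmxA.
have trE xi' : xi' != [ffun => ord0] ->
    Re (\tr (rho *m Phi_xi H xi' M)) = t * (xi == xi')%:R.
  by move=> xi'0; rewrite Re_tr_perturbed_mixed ?mxtrace_Phi_xi // dualX.
rewrite conjT_qnn_U // mulmx_sumr Re_tr_sum (bigD1 [ffun => ord0]) //=; congr (_ + _).
  rewrite -scalemxAr mxtraceZ ReZ big1 ?mul1r // => l _.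
  by rewrite ffunE.
rewrite (bigD1 xi) //= [X in _ + X]big1 ?addr0 => [|xi' /andP[xi'0 ne]].
  by rewrite -scalemxAr mxtraceZ ReZ trE // eqxx mulr1 mulrC.
by rewrite -scalemxAr mxtraceZ ReZ trE // eq_sym (negPf ne) !mulr0.
Qed.

Lemma dual_to_Phi_xi d p (H : 'I_p -> 'M[C]_d) (M : 'M[C]_d) :
  (forall l, is_hermitian (H l)) -> (forall l, H l *m H l = 1%:M) ->
  is_hermitian M -> qnn_lin_indep H M ->
  forall xi : {ffun 'I_p -> 'I_3}, xi != [ffun => ord0] -> exists X : 'M[C]_d,
    [/\ is_hermitian X, \tr X = 0 & forall xi', xi' != [ffun => ord0] ->
       Re (\tr (X *m Phi_xi H xi' M)) = (xi == xi')%:R].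
Proof.
move=> hH HH hM ind xi xi0.
(* The dual family is indexed by ordinals, so the nonzero multi-indices are enumerated through
   [enum_val] and [enum_rank_in]. *)
pose A := [pred xi : {ffun 'I_p -> 'I_3} | xi != [ffun => ord0]].
pose F (i : 'I_#|A|) := Phi_xi H (enum_val i) M.
have [||X /(_ (enum_rank_in (xi0 : xi \in A) xi))[hX trX dualX]] :=
  hermitian_dual_family (F := F).
- by move=> i; exact: Phi_xi_hermitian.
- move=> c c0 i; have eA : enum_val i \in A := enum_valP i.
  have := ind (fun xi' => c (enum_rank_in eA xi')) _ (enum_val i) eA.
  rewrite enum_valK_in; apply.
  rewrite -[RHS]c0 -(eq_bigl (fun xi' => xi' \in A) _ (fun xi' => erefl)) big_enum_val.
  by apply: eq_bigr => j _; rewrite enum_valK_in.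
eexists; split; [exact: hX| |].
  by apply: trX => j; rewrite mxtrace_Phi_xi //; exact: (enum_valP j).
move=> xi' xi'0; have := dualX (enum_rank_in (xi0 : xi \in A) xi').
rewrite /F enum_rankK_in // => ->; congr (nat_of_bool _)%:R.
apply/eqP/eqP => [/(congr1 enum_val)|<- //].
by rewrite !enum_rankK_in.
Qed.

(** * The one-coordinate profile of the loss *)

Definition well (x : R) : R := (2 * sin (x *+ 2)) ^+ 2 + (cos (x *+ 2) - 1) ^+ 2.

Lemma well_ge0 x : 0 <= well x.
Proof. by rewrite addr_ge0 // sqr_ge0. Qed.

Lemma well0 : well 0 = 0.
Proof. by rewrite /well mul0rn sin0 cos0 mulr0 subrr expr0n addr0. Qed.

Lemma well_pihalf : well (pi / 2) = 4.
Proof.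
rewrite /well (_ : pi / 2 *+ 2 = pi :> R); last by field.
by rewrite sinpi cospi; ring.
Qed.

(** With [c = cos 2x], the excess over 4 factors as [(c + 1) (1 - 3 c)]. The window keeps [2x]
    within [pi / 2] of [pi], so [c <= 0] and both factors are nonnegative. *)
Lemma well_local_min_pihalf x : `|x - pi / 2| < pi / 4 -> well (pi / 2) <= well x.
Proof.
rewrite ltr_norml => /andP[lo hi]; rewrite well_pihalf /well.
have -> : (2 * sin (x *+ 2)) ^+ 2 = 4 * (1 - cos (x *+ 2) ^+ 2).
  by have := cos2Dsin2 (x *+ 2); move: (cos _) (sin _) => c s; lra.
have c0 : cos (x *+ 2) <= 0.
  have -> : x *+ 2 = (x - pi / 2) *+ 2 + pi by field.
  rewrite cosDpi oppr_le0; apply: cos_ge0_pihalf; lra.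
have := cos_geN1 (x *+ 2); move: (cos _) c0 => c c0 c1.
rewrite -subr_ge0.
have -> : 4 * (1 - c ^+ 2) + (c - 1) ^+ 2 - 4 = (c - -1) * (1 - 3 * c) by ring.
by apply: mulr_ge0; lra.
Qed.

(** * Multi-indices supported on one coordinate *)

Definition unit_xi p (l : 'I_p) (k : 'I_3) : {ffun 'I_p -> 'I_3} :=
  [ffun m => if m == l then k else ord0].

Lemma unit_xi_neq0 p (l : 'I_p) k : k != ord0 -> unit_xi l k != [ffun => ord0].
Proof. by apply: contraNneq => /ffunP/(_ l); rewrite !ffunE eqxx => ->. Qed.

Lemma unit_xi_inj p (l l' : 'I_p) k k' :
  k != ord0 -> unit_xi l k = unit_xi l' k' -> l = l' /\ k = k'.
Proof.
move=> k0 /ffunP/(_ l); rewrite !ffunE eqxx; case: eqP => // _ e.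
by rewrite e eqxx in k0.
Qed.

Lemma prod_trig_weight_unit_xi p (l : 'I_p) k (theta : 'I_p -> R) :
  \prod_m trig_weight (unit_xi l k m) (theta m) = trig_weight k (theta l).
Proof.
rewrite (bigD1 l) //= big1 => [|m ml]; first by rewrite ffunE eqxx mulr1.
by rewrite ffunE (negPf ml).
Qed.

End ComplexMatrices.

Theorem theorem1 (R : realType) (d p : nat)
  (H : 'I_p -> 'M[R[i]]_d) (M : 'M[R[i]]_d) :
  (2 <= d)%N -> (1 <= p)%N ->
  (forall l, is_hermitian (H l)) ->
  (forall l, H l *m H l = 1%:M) ->
  is_hermitian M ->
  qnn_lin_indep H M ->
  exists S : seq ('M[R[i]]_d * R),
    [/\ S != [::], uniq S, (forall s, s \in S -> density_matrix s.1) &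
      exists pts : 'I_(2 ^ p) -> ('I_p -> R),
        [/\ (forall k k', k != k' -> pts k <> pts k'),
            (forall k l, 0 <= pts k l < pi),
            (forall k, local_min (loss H M S) (pts k)) &
            exists k0 : 'I_(2 ^ p), forall k, k != k0 ->
              exists theta, loss H M S theta < loss H M S (pts k)]].
Proof.
move=> d2 p1 hH HH hM ind.
(* Index 2 selects the sine factor and index 1 the cosine factor. *)
pose kind (b : bool) : 'I_3 := inord (if b then 2 else 1)%N.
have kind0 b : kind b != ord0 by rewrite -val_eqE /= inordK //; case: b.
have kind_inj : injective kind.
  by move=> b b' /(congr1 val) /=; rewrite !inordK; case: b; case: b'.
pose xi (x : 'I_p * bool) := unit_xi x.1 (kind x.2).
have xi0 x : xi x != [ffun => ord0] by exact: unit_xi_neq0.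
have xi_inj : injective xi.
  by move=> [l b] [l' b'] /(unit_xi_inj (kind0 _)) /= [-> /kind_inj ->].
have /choice[X XP] := fun x => dual_to_Phi_xi hH HH hM ind (xi0 x).
have [delta delta_gt0 rho_density] : exists2 delta : R, 0 < delta &
    forall x t, 0 <= t <= delta -> density_matrix (perturbed_mixed (X x) t).
  have /choice[delta deltaP] x : exists delta : R, 0 < delta /\
      forall t, 0 <= t <= delta -> density_matrix (perturbed_mixed (X x) t).
    have [hX trX _] := XP x.
    by have [e ? ?] := perturbed_mixed_density (ltnW d2) hX trX; exists e.
  exists (\big[Num.min/1]_x delta x).
    by apply: lt_bigmin => // x _; have [] := deltaP x.
  move=> x t /andP[t0 tle]; apply: (deltaP x).2; rewrite t0 (le_trans tle) //.
  exact: bigmin_le_cond.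
(* Half of [delta], so that the doubled amplitude [2 * t] is still admissible. *)
pose t := delta / 2.
have t_gt0 : 0 < t by rewrite divr_gt0.
(* The sine needs the larger amplitude: with equal amplitudes
   [sin^2 + (cos - 1)^2 = 2 (1 - cos)] has no second local minimum. *)
pose amp (b : bool) : R := if b then 2 * t else t.
have amp_gt0 b : 0 < amp b by case: b; rewrite /amp ?mulr_gt0.
have amp_le b : amp b <= delta.
  by rewrite /amp /t; case: b; move: delta_gt0; lra.
pose rho (x : 'I_p * bool) := perturbed_mixed (X x) (amp x.2).
(* The label cancels the constant part of the expectation; the extra [t] turns the cosine residual
   into [t * (cos - 1)], which vanishes at angle 0. *)
pose label (x : 'I_p * bool) :=
  complex.Re (\tr (rho x *m Phi_xi H [ffun => ord0] M)) + (if x.2 then 0 else t).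
pose S := [seq (rho x, label x) | x <- enum {: 'I_p * bool}].
have Re_tr_rho x y : complex.Re (\tr (rho x *m Phi_xi H (xi y) M)) =
    amp x.2 * (xi x == xi y)%:R.
  have [_ _ dualX] := XP x; rewrite -(dualX _ (xi0 y)).
  exact/Re_tr_perturbed_mixed/mxtrace_Phi_xi.
(* Pairing with [Phi_xi H (xi x) M] separates the states: it is positive on [rho x] and zero on the
   others. This gives [uniq S]. *)
have rho_inj : injective rho.
  move=> x y rho_xy; have := Re_tr_rho x x; rewrite rho_xy Re_tr_rho eqxx mulr1.
  case: eqP => [/xi_inj -> //|_] /eqP.
  by rewrite mulr0 lt_eqF.
have lossE theta : loss H M S theta =
    (size S)%:R^-1 * \sum_l t ^+ 2 * well (theta l).
  pose f l b := (amp b * trig_weight (kind b) (theta l) - (if b then 0 else t)) ^+ 2.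
  congr (_ * _); rewrite big_map big_enum.
  transitivity (\sum_x f x.1 x.2); last first.
    rewrite -(pair_bigA _ f); apply: eq_bigr => l _; rewrite big_bool.
    rewrite /f /trig_weight /= !inordK // /well /amp.
    by move: (sin _) (cos _) => s c; ring.
  apply: eq_bigr => x _; have [_ _ dualX] := XP x.
  have := perturbed_mixed_expect (amp x.2) theta hH HH (xi0 x) dualX.
  rewrite prod_trig_weight_unit_xi => /= ->; rewrite /label /f.
  by congr (_ ^+ 2); rewrite opprD addrACA subrr add0r.
have S_size : (0 < size S)%N.
  by rewrite size_map -cardE card_prod card_bool card_ord muln_gt0 p1.
have mean_ge0 (u v : R) : (u <= v) -> (size S)%:R^-1 * u <= (size S)%:R^-1 * v.
  by apply: ler_wpM2l; rewrite invr_ge0.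
(* Candidate minima are indexed by bit strings: the bit at [l] chooses between the wells at [0] and
   [pi / 2]. *)
have cardE2 : #|{ffun 'I_p -> bool}| = (2 ^ p)%N by rewrite card_ffun card_bool card_ord.
pose bits (k : 'I_(2 ^ p)) : {ffun 'I_p -> bool} := enum_val (cast_ord (esym cardE2) k).
have bits_inj : injective bits by move=> k k' /enum_val_inj/cast_ord_inj.
pose pts k (l : 'I_p) : R := if bits k l then pi / 2 else 0.
have pi0 := pi_gt0 R.
have pihalf0 : 0 < pi / 2 :> R by rewrite divr_gt0.
exists S; split.
- by rewrite -size_eq0 -lt0n.
- by rewrite map_inj_uniq ?enum_uniq // => x y /(congr1 fst)/rho_inj.
- by move=> _ /mapP[x _ ->] /=; apply: rho_density; rewrite ltW //= amp_le.
exists pts; split.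
- move=> k k' /eqP kk' e; apply/kk'/bits_inj/ffunP => l.
  have := congr1 (@^~ l) e; rewrite /pts; case: (bits k l); case: (bits k' l) => // /eqP.
    by rewrite gt_eqF.
  by rewrite lt_eqF.
- move=> k l; rewrite /pts; case: (bits k l); lra.
(* The loss separates over coordinates, so each is compared alone; [pi / 4] is the window of the
   well at [pi / 2], and at [0] the well is globally minimal. *)
- move=> k; exists (pi / 4) => [|theta' near_pts]; first by rewrite divr_gt0.
  rewrite !lossE; apply/mean_ge0/ler_sum => l _; rewrite ler_wpM2l ?sqr_ge0 //.
  move: (near_pts l); rewrite /pts; case: (bits k l) => [|_]; last by rewrite well0 well_ge0.
  exact: well_local_min_pihalf.
(* The all-false string is the origin, where the loss is 0; any other string has a true bit,
   contributing [4 t^2] to the sum. *)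
pose k0 := cast_ord cardE2 (enum_rank [ffun => false]).
exists k0 => k kk0; exists (fun=> 0); rewrite !lossE ltr_pM2l ?invr_gt0 ?ltr0n //.
rewrite big1 => [|l _]; last by rewrite well0 mulr0.
have [l kl] : exists l, bits k l.
  apply/existsP; apply: contraNT kk0 => /existsPn k_false.
  apply/eqP/bits_inj/ffunP => l; rewrite /bits cast_ordK enum_rankK ffunE.
  exact/negbTE/k_false.
rewrite (bigD1 l) //= ltr_pwDl //.
  by rewrite /pts kl well_pihalf mulr_gt0 // exprn_gt0.
by apply: sumr_ge0 => m _; rewrite mulr_ge0 ?sqr_ge0 ?well_ge0.
Qed.
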